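(* Consider a set of producers $\mathcal N$, production cost functions $C_i$ for every $i\in\mathcal N$, and the affine demand function $D(p)=\gamma(\hat p-p)$ with $\gamma>0$ and $\hat p>0$. If the marginal costs in $0$ are homogeneous, i.e., $C_i'(0)=C_j'(0)$ for all $i,j\in\mathcal N$, then, for every $K>0$, there exists a unique $x^*\in[0,\hat p]^{\mathcal N}$ such that every Nash equilibrium $S^*$ of the $\mathrm{Lip}_K$-pay-as-bid auction game satisfies, for every $i\in\mathcal N$, $$S_i^*(p)=K[p-x_i^*]_+\,,\qquad\forall p\in[0,p^*(S^* )].$$
   Context: Notation: $\mathbb R_+=[0,\infty)$, $[t]_+=\max\{t,0\}$. Market: $\mathcal N=\{1,\dots,n\}$ is a non-empty finite set of producers. Each production cost function $C_i:\mathbb R_+\to\mathbb R_+$ is twice continuously differentiable, non-decreasing and convex. The demand function is $D(p)=\gamma(\hat p-p)$. $\mathrm{Lip}_K$ is the set of non-decreasing functions $F:[0,\hat p]\to\mathbb R_+$ with $F(0)=0$ and $|F(x)-F(y)|\le K|x-y|$ for all $x,y\in[0,\hat p]$. The $\mathrm{Lip}_K$-pay-as-bid auction game is the strategic game with player set $\mathcal N$, where each player $i$ chooses a supply function $S_i\in\mathrm{Lip}_K$. Given $S=(S_1,\dots,S_n)$, the market-clearing price $p^*(S)$ is the unique $p^*\in[0,\hat p]$ with $D(p^* )=\sum_{i=1}^n S_i(p^* )$, and the utility of player $i$ is $$u_i(S)=p^*S_i(p^* )-\int_0^{p^*}S_i(p)\,dp-C_i(S_i(p^* )),\qquad p^*=p^*(S).$$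 $S^*$ is a Nash equilibrium if for every $i$, $S_i^*$ maximizes $u_i(\cdot,S_{-i}^* )$ over $\mathrm{Lip}_K$. (At least one Nash equilibrium of this game exists.) *)

(* Defs.v *)
From HB Require Import structures.
From mathcomp Require Export all_boot all_order all_algebra.
From mathcomp Require Export all_classical all_reals all_analysis.
Export Order.TTheory GRing.Theory Num.Theory.
Export numFieldNormedType.Exports.

Set Implicit Arguments.
Unset Strict Implicit.
Unset Printing Implicit Defensive.

Local Open Scope classical_set_scope.
Local Open Scope ring_scope.

(** A function on the half-line [0, +oo[ or on [0, phat] is represented by a
    total function R -> R; all the notions below only depend on its values on
    the relevant domain. *)

(** Derivative relative to [0, +oo[: two-sided at x > 0, right derivative at
    x = 0. *)
Definition hquot (R : realType) (f : R -> R) (x y : R) : R :=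
  (f y - f x) / (y - x).

Definition hderivable (R : realType) (f : R -> R) : Prop :=
  forall x : R, 0 <= x -> cvg (hquot f x @ within `[0, +oo[ (x^')).

Definition hderiv (R : realType) (f : R -> R) (x : R) : R :=
  lim (hquot f x @ within `[0, +oo[ (x^')).

Definition C2_halfline (R : realType) (f : R -> R) : Prop :=
  [/\ hderivable f, hderivable (hderiv f)
    & {within `[0, +oo[, continuous (hderiv (hderiv f))}].

Definition cost_function (R : realType) (C : R -> R) : Prop :=
  [/\ forall q : R, 0 <= q -> 0 <= C q,
      C2_halfline C,
      {in `[0, +oo[ &, {homo C : x y / x <= y}}
    & convex_function (E := R^o) `[0, +oo[ C].

Definition affine_demand (R : realType) (gamma phat p : R) : R :=
  gamma * (phat - p).

Definition Lip (R : realType) (K phat : R) (F : R -> R) : Prop :=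
  [/\ forall p : R, p \in `[0, phat] -> 0 <= F p,
      F 0 = 0,
      {in `[0, phat] &, {homo F : x y / x <= y}}
    & K.-lipschitz_(`[0, phat]) F].

Definition clears (R : realType) (n : nat) (phat : R) (D : R -> R)
    (S : 'I_n -> R -> R) (p : R) : Prop :=
  p \in `[0, phat] /\ D p = \sum_(i < n) S i p.

(** The default value 0 is never used on admissible profiles, see
    [clearing_price_exists_unique]. *)
Definition clearing_price (R : realType) (n : nat) (phat : R) (D : R -> R)
    (S : 'I_n -> R -> R) : R :=
  xget 0 [set p | clears phat D S p].

Definition utility (R : realType) (n : nat) (phat : R) (D : R -> R)
    (C : 'I_n -> R -> R) (i : 'I_n) (S : 'I_n -> R -> R) : R :=
  let p := clearing_price phat D S in
  p * S i p - \int[@lebesgue_measure R]_(t in `[0, p]) S i t - C i (S i p).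

Definition deviate (R : realType) (n : nat) (S : 'I_n -> R -> R) (i : 'I_n)
    (F : R -> R) : 'I_n -> R -> R :=
  fun j => if j == i then F else S j.

Definition nash_equilibrium (R : realType) (n : nat) (K phat : R) (D : R -> R)
    (C : 'I_n -> R -> R) (S : 'I_n -> R -> R) : Prop :=
  (forall i, Lip K phat (S i)) /\
  (forall i F, Lip K phat F ->
     utility phat D C i (deviate S i F) <= utility phat D C i S).

Lemma Lip_continuous (R : realType) (K phat : R) (F : R -> R) :
  Lip K phat F -> {within `[0, phat], continuous F}.
Proof.
move=> [_ _ _ lF]; apply/subspace_continuousP => x xI.
have {}lF y : `[0, phat]%classic y -> `|F x - F y| <= K * `|x - y|.
  by move=> yI; exact: (lF (x, y) (conj xI yI)).
apply/cvgrPdist_lt => e e0.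
have K1 : 0 < `|K| + 1 by rewrite ltr_wpDl.
rewrite near_withinE.
near=> y => yI; apply: le_lt_trans (lF _ yI) _.
apply: (@le_lt_trans _ _ ((`|K| + 1) * `|x - y|)).
  by rewrite ler_wpM2r// (le_trans (ler_norm K))// lerDl.
rewrite mulrC -ltr_pdivlMr//; near: y.
by apply: cvgr_dist_lt => //; rewrite divr_gt0.
Unshelve. all: by end_near. Qed.

Lemma clearing_price_exists_unique (R : realType) (n : nat) (K gamma phat : R)
    (S : 'I_n -> R -> R) :
  0 < gamma -> 0 < phat -> (forall i, Lip K phat (S i)) ->
  exists! p, clears phat (affine_demand gamma phat) S p.
Proof.
move=> g0 p0 LS.
pose G p := \sum_(i < n) S i p - affine_demand gamma phat p.
have cG : {within `[0, phat], continuous G}.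
  apply/subspace_continuousP => x xI; apply: cvgB.
    apply: cvg_big => [|i _]; first exact: add_continuous.
    by have /subspace_continuousP := Lip_continuous (LS i); exact.
  apply: cvgMl_tmp; apply: cvgB; first exact: cvg_cst.
  exact: cvg_within.
have I0 : 0 \in `[0, phat] by rewrite in_itv/= lexx ltW.
have Ip : phat \in `[0, phat] by rewrite in_itv/= lexx ltW.
have G0 : G 0 <= 0.
  rewrite /G big1 ?sub0r ?oppr_le0 /affine_demand ?subr0 ?mulr_ge0 ?ltW//.
  by move=> i _; case: (LS i).
have Gp : 0 <= G phat.
  rewrite /G /affine_demand subrr mulr0 subr0 sumr_ge0// => i _.
  by case: (LS i) => h _ _ _; exact: h.
have [|c cI Gc] := @IVT R G 0 phat 0 (ltW p0) cG.
  by rewrite ge_min G0 le_max Gp orbT.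
exists c; split; first by split => //; apply/esym/eqP; rewrite -subr_eq0 -/(G c) Gc.
have lt_absurd a b : a \in `[0, phat] -> b \in `[0, phat] -> a < b ->
    affine_demand gamma phat a = \sum_(i < n) S i a ->
    affine_demand gamma phat b = \sum_(i < n) S i b -> False.
  move=> aI bI ab Ea Eb.
  have : \sum_(i < n) S i a <= \sum_(i < n) S i b.
    by apply: ler_sum => i _; case: (LS i) => _ _ mS _; apply: mS => //; exact: ltW.
  by rewrite -Ea -Eb /affine_demand ler_pM2l// lerD2l lerN2 leNgt ab.
move=> q [qI Eq].
have Ec : affine_demand gamma phat c = \sum_(i < n) S i c.
  by apply/esym/eqP; rewrite -subr_eq0 -/(G c) Gc.
by case: (ltgtP c q) => // h; [case: (lt_absurd c q)|case: (lt_absurd q c)].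
Qed.

(* Main.v *)
From mathcomp Require Import ring lra.
Require Import Defs.

(** Fix all the supply functions but that of producer [i], and suppose that the
    market clears at price [p] with [i] selling [q].  Among the functions of
    [Lip K phat] taking the value [q] at [p], the ramp
    [t |-> K * max (t - x) 0] with [x = p - q / K] is the smallest on [0, p];
    and once [p] and [q] are given, the utility depends on the supply function
    only through its integral over [0, p], with which it decreases.  Hence
    equilibrium supplies are ramps up to the clearing price ([nash_ramp]), and a
    ramp earns [p q - q ^ 2 / (2 K) - C_i q] ([utility_ramp]).

    Put [M = gamma + (n - 1) K] and [g_i q = q / M + q / K + C_i' q].  No
    residual demand is steeper than [M], so a producer with [q > 0] who raises
    the price slightly shows that [g_i q <= p] ([nash_supply_price_le]).  If all
    the producers are active at [p], their ramps have slope [K] just below [p],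
    the residual demand has slope exactly [M] there, and lowering the price
    shows that [p <= g_i q].  Homogeneity of the marginal costs at 0 leaves only
    one other case: an inactive producer would enter as soon as [p] exceeded the
    common marginal cost [c = C_i' 0], so [p <= c], and then
    [c <= C_j' q < g_j q <= p] forbids any active producer.  Hence every
    equilibrium quantity satisfies [0 <= q], [p <= g_i q], with equality when
    [q > 0] ([nash_best_supply]).

    Since [g_i] increases with slope at least [1 / K], this condition defines
    [q] as a function of [p] that is itself in [Lip K phat] ([supply_Lip]).
    Clearing the market against these functions determines the price, hence the
    quantities and the thresholds [x_i].  The corresponding ramps do form an
    equilibrium ([ramp_nash]) because the marginal costs increase; this
    existence is what makes the thresholds unique.  The threshold of a producer
    selling nothing is visible only because in that case nobody sells, so that
    the clearing price is [phat]. *)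

Set Implicit Arguments.
Unset Strict Implicit.
Unset Printing Implicit Defensive.

Local Open Scope classical_set_scope.
Local Open Scope ring_scope.

(** * Marginal costs *)

Lemma hderiv_approx (R : realType) (f : R -> R) (x e : R) :
  hderivable f -> 0 <= x -> 0 < e ->
  exists2 r, 0 < r & forall y, 0 <= y -> y != x -> `|y - x| < r ->
    `|hquot f x y - hderiv f x| < e.
Proof.
move=> df x0 e0; have /cvgrPdist_lt/(_ e e0) := df x x0.
rewrite !near_withinE => -[r /= r0 rP]; exists r => // y y0 yx ryx.
rewrite distrC; apply: rP => //=; [by rewrite distrC|by rewrite in_itv/= y0].
Qed.

(** A function derivable on the half-line is continuous there, in epsilon-delta
    form. *)
Lemma hderivable_continuous (R : realType) (f : R -> R) (x e : R) :
  hderivable f -> 0 <= x -> 0 < e ->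
  exists2 r, 0 < r & forall y, 0 <= y -> `|y - x| < r -> `|f y - f x| < e.
Proof.
move=> df x0 e0; have [r r0 rP] := hderiv_approx df x0 (@ltr01 R).
set l := hderiv f x in rP.
have l1 : 0 < `|l| + 1 by rewrite ltr_wpDl.
exists (Num.min r (e / (`|l| + 1))); first by rewrite lt_min r0 divr_gt0.
move=> y y0; rewrite lt_min => /andP[yr ye].
have [->|yx] := eqVneq y x; first by rewrite subrr normr0.
have yx0 : y - x != 0 by rewrite subr_eq0.
have -> : f y - f x = hquot f x y * (y - x) by rewrite /hquot divfK.
rewrite normrM (@le_lt_trans _ _ ((`|l| + 1) * `|y - x|))//.
  rewrite ler_wpM2r// -[hquot f x y](subrK l) addrC.
  by rewrite (le_trans (ler_normD _ _))// lerD2l ltW// rP.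
by rewrite mulrC -ltr_pdivlMr.
Qed.

Lemma cost_convex (R : realType) (C : R -> R) (x y t : R) :
  cost_function C -> 0 <= x -> 0 <= y -> 0 <= t <= 1 ->
  C (t * y + (1 - t) * x) <= t * C y + (1 - t) * C x.
Proof.
case=> _ _ _ cC x0 y0 /andP[t0 t1].
have := cC (Itv01 t0 t1) y x.
rewrite !inE/= !in_itv/= x0 y0 => /(_ isT isT).
by rewrite /conv/=.
Qed.

Lemma cost_subgradient (R : realType) (C : R -> R) (x y : R) :
  cost_function C -> 0 <= x -> 0 <= y ->
  C x + hderiv C x * (y - x) <= C y.
Proof.
move=> hC x0 y0; have [->|yx] := eqVneq y x; first by rewrite subrr mulr0 addr0.
have yx0 : 0 < `|y - x| by rewrite normr_gt0 subr_eq0.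
apply/ler_addgt0Pr => e e0.
have [_ [dC _ _] _ _] := hC.
have [r r0 rP] := hderiv_approx dC x0 (divr_gt0 e0 yx0).
(* A point z of the segment from x to y, within r of x: by convexity the
   increment of C from x to z is at most a fraction t of the one to y. *)
pose t := Num.min 1 (r / 2 / `|y - x|).
have t0 : 0 < t by rewrite lt_min ltr01 !divr_gt0.
have t1 : t <= 1 by rewrite ge_min lexx.
pose z := t * y + (1 - t) * x.
have zx : z - x = t * (y - x) by rewrite /z; ring.
have z0 : 0 <= z by rewrite addr_ge0 ?mulr_ge0 ?subr_ge0// ltW.
have zx0 : z - x != 0 by rewrite zx mulf_neq0 ?(gt_eqF t0)// -normr_gt0.
have zr : `|z - x| < r.
  rewrite zx normrM gtr0_norm// -ltr_pdivlMr// gt_min; apply/orP; right.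
  by rewrite ltr_pM2r ?invr_gt0// ltr_pdivrMr// ltr_pMr// ltr1n.
have := rP z z0; rewrite -subr_eq0 => /(_ zx0 zr) h.
have hz : hquot C x z * (y - x) <= C y - C x.
  have := @cost_convex _ _ x y t hC x0 y0; rewrite ltW// t1 => /(_ isT).
  rewrite -/z => cz.
  have E : hquot C x z * (y - x) * t = C z - C x.
    by rewrite -mulrA [_ * t]mulrC -zx /hquot divfK.
  rewrite -(ler_pM2r t0) E; lra.
have : (hderiv C x - hquot C x z) * (y - x) <= e.
  apply: (le_trans (ler_norm _)); rewrite normrM distrC -ler_pdivlMr//.
  exact: ltW.
lra.
Qed.

Lemma marginal_cost_le (R : realType) (C : R -> R) (x y : R) :
  cost_function C -> 0 <= x -> x <= y -> hderiv C x <= hderiv C y.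
Proof.
move=> hC x0; rewrite le_eqVlt => /predU1P[->//|xy].
have y0 : 0 <= y by rewrite (le_trans x0)// ltW.
have := cost_subgradient hC x0 y0; have := cost_subgradient hC y0 x0.
move=> h1 h2; rewrite -(@ler_pM2r _ (y - x)) ?subr_gt0//; lra.
Qed.

Lemma marginal_cost_ge0 (R : realType) (C : R -> R) (x : R) :
  cost_function C -> 0 <= x -> 0 <= hderiv C x.
Proof.
move=> hC x0; apply/ler_addgt0Pr => e e0.
have [_ [dC _ _] mC _] := hC.
have [r r0 rP] := hderiv_approx dC x0 e0.
have r2 : 0 < r / 2 by rewrite divr_gt0.
have := rP (x + r / 2).
rewrite (addr_ge0 x0 (ltW r2)) -subr_eq0 addrAC subrr add0r (gt_eqF r2).
rewrite gtr0_norm// ltr_pdivrMr// ltr_pMr// ltr1n => /(_ isT isT isT).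
have : 0 <= hquot C x (x + r / 2).
  rewrite /hquot addrAC subrr add0r divr_ge0 ?(ltW r2)// subr_ge0.
  by apply: mC; rewrite ?in_itv/= ?andbT ?addr_ge0 ?lerDl// ltW.
move=> h0 /ltr_distlDr; lra.
Qed.

(** * Lipschitz supply functions and ramps *)

(** The function that vanishes up to the threshold [x], then grows with
    slope [K]. *)
Definition ramp (R : realType) (K x : R) : R -> R :=
  fun p => K * Num.max (p - x) 0.

Lemma ramp_Lip (R : realType) (K phat x : R) :
  0 < K -> 0 <= x -> Lip K phat (ramp K x).
Proof.
move=> K0 x0; split.
- by move=> p _; rewrite mulr_ge0 ?(ltW K0)// le_max lexx orbT.
- by rewrite /ramp sub0r max_r ?mulr0// oppr_le0.
- move=> a b _ _ ab; rewrite ler_pM2l// ge_max !le_max lexx orbT andbT.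
  by rewrite lerD2r ab.
- move=> [a b] _ /=; rewrite /ramp -mulrBr normrM gtr0_norm// ler_pM2l//.
  by rewrite ler_norml; case: (leP (a - x) 0); case: (leP (b - x) 0);
    case: (ger0P (a - b)); move=> *; apply/andP; split; lra.
Qed.

Lemma Lip_ge_ramp (R : realType) (K phat p t : R) (F : R -> R) :
  0 < K -> Lip K phat F -> p \in `[0, phat] -> t \in `[0, p] ->
  ramp K (p - F p / K) t <= F t.
Proof.
move=> K0 [F0 _ mF lF]; rewrite !in_itv/= => /andP[p0 pp] /andP[t0 tp].
have tI : t \in `[0, phat] by rewrite in_itv/= t0 (le_trans tp).
have pI : p \in `[0, phat] by rewrite in_itv/= p0.
have Ft := F0 _ tI.
have /= := lF (t, p) (conj tI pI).
rewrite distrC [X in _ * X]distrC ger0_norm ?subr_ge0 ?mF//.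
rewrite ger0_norm ?subr_ge0//.
move=> h; rewrite /ramp -[K * _]mulrC -ler_pdivlMr// ge_max.
rewrite divr_ge0 ?(ltW K0)// andbT ler_pdivlMr// !mulrBl divfK ?gt_eqF//; lra.
Qed.

Lemma Lip_le (R : realType) (K phat p : R) (F : R -> R) :
  Lip K phat F -> p \in `[0, phat] -> F p <= K * p.
Proof.
move=> [F0 F00 mF lF] pI; move: (pI); rewrite in_itv/= => /andP[p0 pp].
have I0 : 0 \in `[0, phat] by rewrite in_itv/= lexx (le_trans p0).
have /= := lF (p, 0) (conj pI I0).
by rewrite F00 !subr0 !ger0_norm// F0.
Qed.

(** * Integrals *)

Local Notation mu := (@lebesgue_measure _).

Lemma Rintegral_continuous_gt0 (R : realType) (h : R -> R) (p t : R) :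
  0 < p -> {within `[0, p], continuous h} ->
  (forall x, x \in `[0, p] -> 0 <= h x) -> t \in `[0, p] -> 0 < h t ->
  0 < \int[@lebesgue_measure R]_(x in `[0, p]) h x.
Proof.
move=> p0 ch h0 tI ht.
have ih : mu.-integrable `[0, p] (EFin \o h).
  by apply: continuous_compact_integrable => //; exact: segment_compact.
have ht2 : 0 < h t / 2 by rewrite divr_gt0.
have /subspace_continuousP/(_ t tI) := ch.
move=> /cvgrPdist_lt/(_ _ ht2); rewrite near_withinE => -[r /= r0 rP].
(* On [a, b] the integrand exceeds h t / 2. *)
pose a := Num.max 0 (t - r / 2); pose b := Num.min p (t + r / 2).
move: (tI); rewrite in_itv/= => /andP[t0 tp].
have ab : a < b.
  rewrite gt_max !lt_min p0/=; apply/andP; split; first lra.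
  by apply/andP; split; lra.
have a0 : 0 <= a by rewrite le_max lexx.
have bp : b <= p by rewrite ge_min lexx.
have at_ : t - r / 2 <= a by rewrite le_max lexx orbT.
have bt : b <= t + r / 2 by rewrite ge_min lexx orbT.
have sub : `[a, b] `<=` `[0, p].
  by apply: subset_itv; rewrite bnd_simp.
have ih' : mu.-integrable `[a, b] (EFin \o h) by apply: integrableS ih.
apply: (@lt_le_trans _ _ (h t / 2 * (b - a))).
  by rewrite mulr_gt0// subr_gt0.
apply: (@le_trans _ _ (\int[@lebesgue_measure R]_(x in `[a, b]) h x)).
  have -> : h t / 2 * (b - a) =
      \int[@lebesgue_measure R]_(x in `[a, b]) (h t / 2).
    by rewrite Rintegral_cst//= lebesgue_measure_itv/= lte_fin ab.
  apply: le_Rintegral => //.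
    apply: continuous_compact_integrable; first exact: segment_compact.
    by apply: continuous_subspaceT => x; exact: cvg_cst.
  move=> x /= xab; have xI : x \in `[0, p] by exact: sub.
  move: xab; rewrite in_itv/= => /andP[ax xb].
  have : `|h t - h x| < h t / 2.
    by apply: rP => //=; rewrite ltr_norml; apply/andP; split; lra.
  move=> /ltr_distlDr; lra.
rewrite /Rintegral fine_le//.
- exact: integrable_fin_num.
- exact: integrable_fin_num.
- apply: ge0_subset_integral => //.
  by have /integrableP[] := ih.
Qed.

Lemma Rintegral_ramp (R : realType) (K x p : R) :
  0 < K -> 0 <= x -> x <= p ->
  \int[@lebesgue_measure R]_(t in `[0, p]) ramp K x t = K * (p - x) ^+ 2 / 2.
Proof.
move=> K0 x0 xp; have cr := Lip_continuous (ramp_Lip p K0 x0).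
have ir : mu.-integrable `[0, p] (EFin \o ramp K x).
  by apply: continuous_compact_integrable => //; exact: segment_compact.
have := @Rintegral_itvB R (ramp K x) (BLeft 0) (BRight p) x ir.
rewrite !bnd_simp => /(_ x0 xp).
rewrite [X in _ - X](_ : _ = 0); last first.
  rewrite (@eq_Rintegral _ _ _ _ _ (fun=> 0)) ?Rintegral_cst ?mul0r// => t.
  rewrite inE/= in_itv/= => /andP[_ tx].
  by rewrite /ramp max_r ?mulr0// subr_le0.
rewrite subr0 => ->.
rewrite Rintegral_itv_obnd_cbnd; last first.
  by apply: integrableS ir => //; apply: subset_itv; rewrite bnd_simp.
move: xp; rewrite le_eqVlt => /predU1P[<-|xp].
  by rewrite set_itv1 Rintegral_set1 subrr expr0n/= mulr0 mul0r.
pose F : R -> R := (K / 2) \*: (id - cst x) ^+ 2.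
have dF (t : R) : is_derive t (1 : R) F (K * (t - x)).
  rewrite /F; apply: is_derive_eq.
  by rewrite /GRing.scale/= subr0 expr1 !fctE/=; field.
have cF : continuous F.
  move=> t; apply: differentiable_continuous.
  by apply/derivable1_diffP; case: (dF t).
rewrite /Rintegral (@continuous_FTC2 _ _ F)//.
- by rewrite /F !fctE /= subrr expr0n scaler0 subr0 /GRing.scale/=; field.
- refine (continuous_subspaceW _ cr).
  by apply: subset_itv; rewrite bnd_simp.
- split.
  + by move=> t _; have [] := dF t.
  + exact/cvg_at_right_filter/cF.
  + exact/cvg_at_left_filter/cF.
- move=> t; rewrite in_itv/= => /andP[xt _].
  rewrite derive1E (@derive_val _ _ _ _ _ _ _ (dF t)).
  by rewrite /ramp max_l// subr_ge0 ltW.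
Qed.

(** * Utilities and payoffs *)

Section Game.
Context (R : realType) (n : nat) (K gamma phat : R) (C : 'I_n -> R -> R).
Context (K0 : 0 < K) (gamma0 : 0 < gamma) (phat0 : 0 < phat).
Context (hC : forall i, cost_function (C i)).

Local Notation D := (affine_demand gamma phat).
Local Notation profile := ('I_n -> R -> R).
Local Notation price := (clearing_price phat D).
Implicit Types (S : profile) (i j : 'I_n) (p q x : R).

(** The total supply of the producers other than [i]. *)
Definition rivals S i p : R := \sum_(j < n | j != i) S j p.

(** The utility of producer [i] when the market clears at price [p] and [i]
    sells [q] through a ramp of slope [K]. *)
Definition payoff i p q : R := p * q - q ^+ 2 / (2 * K) - C i q.

(** The largest possible slope, in absolute value, of the residual demand faced
    by a producer. *)
Definition residual_slope : R := gamma + K * n.-1%:R.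

Local Notation M := residual_slope.

Lemma gamma_le_slope : gamma <= M.
Proof. by rewrite lerDl mulr_ge0 ?(ltW K0). Qed.

Lemma residual_slope_gt0 : 0 < M.
Proof. exact: lt_le_trans gamma_le_slope. Qed.

Lemma price_clears S :
  (forall i, Lip K phat (S i)) -> clears phat D S (price S).
Proof.
move=> LS; have [p [pS _]] := clearing_price_exists_unique gamma0 phat0 LS.
by rewrite /clearing_price; apply: xgetPex; exists p.
Qed.

Lemma price_eq S p :
  (forall i, Lip K phat (S i)) -> clears phat D S p -> price S = p.
Proof.
move=> LS cp; have [p' [_ uS]] := clearing_price_exists_unique gamma0 phat0 LS.
by rewrite -(uS _ cp); apply/esym/uS/price_clears.
Qed.

Lemma deviate_same S i F : deviate S i F i = F.
Proof. by rewrite /deviate eqxx. Qed.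

Lemma deviate_self S i : deviate S i (S i) = S.
Proof. by apply/funext => j; rewrite /deviate; case: eqP => [->|]. Qed.

Lemma deviate_Lip S i F : (forall j, Lip K phat (S j)) -> Lip K phat F ->
  forall j, Lip K phat (deviate S i F j).
Proof. by move=> LS LF j; rewrite /deviate; case: ifP. Qed.

Lemma sum_rivals S i p : \sum_(j < n) S j p = S i p + rivals S i p.
Proof. by rewrite (bigD1 i). Qed.

Lemma sum_deviate S i F p :
  \sum_(j < n) deviate S i F j p = F p + rivals S i p.
Proof.
rewrite (sum_rivals _ i) deviate_same; congr (_ + _).
by apply: eq_bigr => j /negbTE ji; rewrite /deviate ji.
Qed.

Lemma sum_rivals_const i (a : R) : \sum_(j < n | j != i) a = n.-1%:R * a.
Proof. by rewrite sumr_const cardC1 card_ord mulr_natl. Qed.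

(** Equality holds exactly when the supply function is a ramp up to the clearing
    price. *)
Lemma utility_le_payoff S i : (forall j, Lip K phat (S j)) ->
  utility phat D C i S <= payoff i (price S) (S i (price S)) ?= iff
    `[< forall t, t \in `[0, price S] ->
          S i t = ramp K (price S - S i (price S) / K) t >].
Proof.
move=> LS; have [pI _] := price_clears LS.
rewrite /utility; set p := price S in pI *; set q := S i p.
move: (pI); rewrite in_itv/= => /andP[p0 pp].
have [S0 _ _ _] := LS i.
have q0 : 0 <= q by exact: S0.
have x0 : 0 <= p - q / K.
  by rewrite subr_ge0 ler_pdivrMr// mulrC (Lip_le (LS i)).
have xp : p - q / K <= p by rewrite gerBl divr_ge0 ?(ltW K0).
have sub : `[0, p] `<=` `[0, phat] by apply: subset_itv; rewrite bnd_simp.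
have cS : {within `[0, p], continuous (S i)}.
  exact: continuous_subspaceW (Lip_continuous (LS i)).
have cr : {within `[0, p], continuous (ramp K (p - q / K))}.
  exact: Lip_continuous (ramp_Lip _ K0 x0).
have iS : mu.-integrable `[0, p] (EFin \o S i).
  by apply: continuous_compact_integrable => //; exact: segment_compact.
have ir : mu.-integrable `[0, p] (EFin \o ramp K (p - q / K)).
  by apply: continuous_compact_integrable => //; exact: segment_compact.
have h0 t : t \in `[0, p] -> 0 <= S i t - ramp K (p - q / K) t.
  by move=> tI; rewrite subr_ge0; exact: Lip_ge_ramp tI.
have E : q ^+ 2 / (2 * K) =
    \int[@lebesgue_measure R]_(t in `[0, p]) ramp K (p - q / K) t.
  rewrite Rintegral_ramp//; field; exact: lt0r_neq0.
have IB :
    \int[@lebesgue_measure R]_(t in `[0, p]) (S i t - ramp K (p - q / K) t)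
    = \int[@lebesgue_measure R]_(t in `[0, p]) S i t - q ^+ 2 / (2 * K).
  by rewrite RintegralB// -E.
apply/leifP; case: asboolP => [eS|neS].
  apply/eqP; rewrite /payoff E; congr (_ - _ - _).
  by apply: eq_Rintegral => t; rewrite inE; exact: eS.
have [t [tI tS]] : exists t, t \in `[0, p] /\ 0 < S i t - ramp K (p - q / K) t.
  apply: contrapT => /forallNP h; apply: neS => t tI.
  apply/eqP; rewrite -subr_eq0 eq_le h0// andbT leNgt; apply/negP => ht.
  by apply: (h t).
have pgt0 : 0 < p.
  rewrite lt_neqAle p0 andbT; apply/eqP => p00.
  have tp : t = p by apply/eqP; move: tI; rewrite in_itv/= -p00 eq_le andbC.
  move: tS; rewrite tp -/q /ramp subKr max_l ?divr_ge0 ?(ltW K0)//.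
  by rewrite mulrC divfK ?lt0r_neq0// subrr ltxx.
have cB : {within `[0, p], continuous (fun t => S i t - ramp K (p - q / K) t)}.
  by move=> z; apply: cvgB; [exact: cS|exact: cr].
have := Rintegral_continuous_gt0 pgt0 cB h0 tI tS.
rewrite IB /payoff; lra.
Qed.

Lemma utility_ramp S i x : (forall j, Lip K phat (S j)) -> 0 <= x ->
  x <= price S -> S i = ramp K x ->
  utility phat D C i S = payoff i (price S) (S i (price S)).
Proof.
move=> LS x0 xp Sx; apply/eqP; rewrite (utility_le_payoff i LS).2.
apply/asboolP => t _; rewrite Sx; congr (ramp _ _ _).
by rewrite /ramp max_l ?subr_ge0// mulrAC divff ?lt0r_neq0// mul1r subKr.
Qed.

(** A producer can force any price [p] at which the residual demand [q] lies
    between [0] and [K * p], by deviating to the ramp through [(p, q)]. *)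
Lemma nash_payoff_le S i p q : nash_equilibrium K phat D C S ->
  p \in `[0, phat] -> 0 <= q -> q <= K * p -> D p = q + rivals S i p ->
  payoff i p q <= utility phat D C i S.
Proof.
move=> [LS NS] pI q0 qK Dp.
have x0 : 0 <= p - q / K by rewrite subr_ge0 ler_pdivrMr// mulrC.
have Lr := ramp_Lip phat K0 x0.
have rq : ramp K (p - q / K) p = q.
  by rewrite /ramp subKr max_l ?divr_ge0 ?(ltW K0)// mulrC divfK ?lt0r_neq0.
apply: le_trans (NS i _ Lr).
have LD := deviate_Lip i LS Lr.
have pE : price (deviate S i (ramp K (p - q / K))) = p.
  by apply: price_eq => //; split => //; rewrite sum_deviate rq.
rewrite (utility_ramp LD x0) ?deviate_same// pE ?rq//.
by rewrite gerBl divr_ge0 ?(ltW K0).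
Qed.

Lemma nash_ramp S i t : nash_equilibrium K phat D C S -> t \in `[0, price S] ->
  S i t = ramp K (price S - S i (price S) / K) t.
Proof.
move=> NS; have [LS _] := NS; have [pI Dp] := price_clears LS.
have UP := utility_le_payoff i LS.
suff /eqP : utility phat D C i S = payoff i (price S) (S i (price S)).
  by rewrite UP.2 => /asboolP; apply.
apply/eqP; rewrite eq_le UP.1/=; apply: nash_payoff_le => //.
- by have [S0 _ _ _] := LS i; exact: S0.
- exact: Lip_le (LS i) pI.
- by rewrite -sum_rivals.
Qed.

(** * First-order conditions at an equilibrium *)

Lemma rivals_le S i a b : (forall j, Lip K phat (S j)) ->
  a \in `[0, phat] -> b \in `[0, phat] -> a <= b ->
  0 <= rivals S i b - rivals S i a <= K * n.-1%:R * (b - a).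
Proof.
move=> LS aI bI ab; rewrite -sumrB; apply/andP; split.
  apply: sumr_ge0 => j _; rewrite subr_ge0.
  by have [_ _ + _] := LS j; apply.
rewrite -mulrA mulrCA -(sum_rivals_const i); apply: ler_sum => j _.
have [_ _ _ /(_ (b, a) (conj bI aI))/=] := LS j.
by rewrite [X in _ <= _ * X]ger0_norm ?subr_ge0//; apply/le_trans/ler_norm.
Qed.

(** The price at which a producer facing a residual demand of slope
    [residual_slope] wants to sell [q > 0]: the solution in [p] of the
    first-order condition [p - q / K - C_i' q = q / M]. *)
Definition supply_price i q : R := q / M + q / K + hderiv (C i) q.

(** First-order condition for raising the price: the price moves by [eps], the
    quantity sold drops by [delta], with [gamma * eps <= delta <= M * eps]. *)
Lemma nash_supply_price_le S i : nash_equilibrium K phat D C S ->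
  0 < S i (price S) -> supply_price i (S i (price S)) <= price S.
Proof.
move=> NS q0; have [LS _] := NS; have [pI Dp] := price_clears LS.
have UP := (utility_le_payoff i LS).1.
set p := price S in pI Dp q0 UP *; set q := S i p in q0 UP *.
have M0 := residual_slope_gt0.
rewrite (sum_rivals _ i) -/q in Dp.
move: (pI); rewrite in_itv/= => /andP[p0 pp].
apply/ler_addgt0Pr => e e0; have e2 : 0 < e / 2 by rewrite divr_gt0.
have [_ [_ dC' _] _ _] := hC i.
have [r r0 rP] := hderivable_continuous dC' (ltW q0) e2.
have MK0 : 0 < 1 + M / (2 * K) by rewrite addr_gt0// divr_gt0// mulr_gt0.
near (0:R)^'+ => eps.
have eps0 : 0 < eps by [].
have epsr : M * eps < r.
  rewrite mulrC -ltr_pdivlMr//; near: eps; apply: nbhs_right_lt.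
  by rewrite divr_gt0.
have epsq : M * eps < q.
  rewrite mulrC -ltr_pdivlMr//; near: eps; apply: nbhs_right_lt.
  by rewrite divr_gt0.
have epse : eps * (1 + M / (2 * K)) < e / 2.
  rewrite -ltr_pdivlMr//; near: eps; apply: nbhs_right_lt.
  by rewrite divr_gt0.
have rp0 : 0 <= rivals S i p.
  by apply: sumr_ge0 => j _; have [S0 _ _ _] := LS j; exact: S0.
have gM : gamma * eps <= M * eps by rewrite ler_pM2r// gamma_le_slope.
have pphat : p + eps <= phat.
  rewrite -lerBrDl -(ler_pM2l gamma0) -/(D p) Dp; lra.
have p'I : p + eps \in `[0, phat] by rewrite in_itv/= pphat addr_ge0// ltW.
have lep : p <= p + eps by rewrite lerDl ltW.
have /andP[] := rivals_le i LS pI p'I lep.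
set d := rivals S i (p + eps) - rivals S i p.
rewrite addrAC subrr add0r => d0 dK.
pose delta := gamma * eps + d.
have ge0 : 0 < gamma * eps by rewrite mulr_gt0.
have delta0 : 0 < delta by rewrite /delta; lra.
have deltaM : delta <= M * eps by rewrite /delta /M mulrDl; lra.
have q'0 : 0 <= q - delta by lra.
have qK : q <= K * p := Lip_le (LS i) pI.
have /(_ q'0) := @nash_payoff_le S i (p + eps) (q - delta) NS p'I.
have -> : q - delta <= K * (p + eps).
  by rewrite mulrDr; have := mulr_gt0 K0 eps0; lra.
have -> : D (p + eps) = q - delta + rivals S i (p + eps).
  by move: Dp; rewrite /delta /d /affine_demand => Dp; lra.
move=> /(_ isT erefl) /le_trans /(_ UP).
have subg := cost_subgradient (hC i) q'0 (ltW q0).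
have : `|hderiv (C i) (q - delta) - hderiv (C i) q| < e / 2.
  by apply: rP => //; rewrite addrAC subrr add0r normrN gtr0_norm//; lra.
move=> /ltr_distlCBl; rewrite /payoff /supply_price.
set c' := hderiv (C i) (q - delta) in subg *.
set c := hderiv (C i) q => cc' ineq.
have h1 : c' * delta <= C i q - C i (q - delta) by lra.
have h2 : delta * q / M <= eps * q.
  by rewrite ler_pdivrMr//; have := ler_wpM2r (ltW q0) deltaM; lra.
have h3 : delta / (2 * K) <= eps * (M / (2 * K)).
  by rewrite mulrA ler_pM2r ?invr_gt0 ?mulr_gt0// mulrC.
rewrite -(ler_pM2l delta0).
have h4 : delta * (eps + delta / (2 * K)) <= delta * (e / 2).
  by rewrite ler_pM2l//; lra.
have h5 : delta * (c - e / 2) <= delta * c' by rewrite ler_pM2l//; lra.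
have E : (q - delta) ^+ 2 / (2 * K) =
    q ^+ 2 / (2 * K) - delta * (q / K) + delta * (delta / (2 * K)).
  by field; exact: lt0r_neq0.
rewrite E in ineq; lra.
Unshelve. all: by end_near.
Qed.

(** First-order condition for lowering the price, when the residual demand falls
    with slope at least [m] just below the clearing price.  The assumption
    [S i p < K * p] leaves room for selling more at a lower price. *)
Lemma nash_price_le_of_slope S i m e0 : nash_equilibrium K phat D C S ->
  S i (price S) < K * price S -> 0 < m -> 0 < e0 ->
  (forall e, 0 < e -> e < e0 ->
    (m - gamma) * e <= rivals S i (price S) - rivals S i (price S - e)) ->
  price S <= S i (price S) / m + S i (price S) / K
             + hderiv (C i) (S i (price S)).
Proof.
move=> NS qK m0 e00 mP; have [LS _] := NS; have [pI Dp] := price_clears LS.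
have UP := (utility_le_payoff i LS).1.
set p := price S in pI Dp qK UP mP *; set q := S i p in qK UP *.
have M0 := residual_slope_gt0.
rewrite (sum_rivals _ i) -/q in Dp.
move: (pI); rewrite in_itv/= => /andP[p0 pp].
have q0 : 0 <= q by have [S0 _ _ _] := LS i; exact: S0.
have pgt0 : 0 < p by rewrite -(pmulr_rgt0 _ K0) (le_lt_trans q0).
apply/ler_addgt0Pr => e e_gt0; have e2 : 0 < e / 2 by rewrite divr_gt0.
have [_ [_ dC' _] _ _] := hC i.
have [r r0 rP] := hderivable_continuous dC' q0 e2.
have MK : 0 < M + K by rewrite addr_gt0.
have MK0 : 0 < 1 + M / (2 * K) by rewrite addr_gt0// divr_gt0// mulr_gt0.
near (0:R)^'+ => eps.
have eps0 : 0 < eps by [].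
have epse0 : eps < e0 by near: eps; apply: nbhs_right_lt.
have epsp : eps < p by near: eps; apply: nbhs_right_lt.
have epsr : M * eps < r.
  rewrite mulrC -ltr_pdivlMr//; near: eps; apply: nbhs_right_lt.
  by rewrite divr_gt0.
have epsq : eps * (M + K) < K * p - q.
  rewrite -ltr_pdivlMr//; near: eps; apply: nbhs_right_lt.
  by rewrite divr_gt0// subr_gt0.
have epse : eps * (1 + M / (2 * K)) < e / 2.
  rewrite -ltr_pdivlMr//; near: eps; apply: nbhs_right_lt.
  by rewrite divr_gt0.
have p'I : p - eps \in `[0, phat] by rewrite in_itv/=; apply/andP; split; lra.
have lep : p - eps <= p by rewrite gerBl ltW.
have /andP[] := rivals_le i LS p'I pI lep.
have := mP _ eps0 epse0.
set d := rivals S i p - rivals S i (p - eps).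
rewrite subKr => dm d0 dK.
pose delta := gamma * eps + d.
have deltam : m * eps <= delta by rewrite /delta; lra.
have deltaM : delta <= M * eps by rewrite /delta /M mulrDl; lra.
have delta0 : 0 < delta by apply: lt_le_trans deltam; rewrite mulr_gt0.
have q'0 : 0 <= q + delta by lra.
have /(_ q'0) := @nash_payoff_le S i (p - eps) (q + delta) NS p'I.
have -> : q + delta <= K * (p - eps) by lra.
have -> : D (p - eps) = q + delta + rivals S i (p - eps).
  by move: Dp; rewrite /delta /d /affine_demand => Dp; lra.
move=> /(_ isT erefl) /le_trans /(_ UP).
have subg := cost_subgradient (hC i) q'0 q0.
have : `|hderiv (C i) (q + delta) - hderiv (C i) q| < e / 2.
  by apply: rP => //; rewrite addrAC subrr add0r gtr0_norm//; lra.
move=> /ltr_distlDr; rewrite /payoff.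
set c' := hderiv (C i) (q + delta) in subg *.
set c := hderiv (C i) q => cc' ineq.
have h1 : C i (q + delta) - C i q <= c' * delta by lra.
have h2 : eps * q <= delta * (q / m).
  by rewrite mulrA ler_pdivlMr//; have := ler_wpM2r q0 deltam; lra.
have h3 : delta / (2 * K) <= eps * (M / (2 * K)).
  by rewrite mulrA ler_pM2r ?invr_gt0 ?mulr_gt0// mulrC.
rewrite -(ler_pM2l delta0).
have h4 : delta * (eps + delta / (2 * K)) <= delta * (e / 2).
  by rewrite ler_pM2l//; lra.
have h5 : delta * c' <= delta * (c + e / 2) by rewrite ler_pM2l//; lra.
have E : (q + delta) ^+ 2 / (2 * K) =
    q ^+ 2 / (2 * K) + delta * (q / K) + delta * (delta / (2 * K)).
  by field; exact: lt0r_neq0.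
rewrite E in ineq; lra.
Unshelve. all: by end_near.
Qed.

(** The first-order conditions for selling [q] at price [p]: [supply_price i q]
    equals [p] if [q > 0], and is at least [p] if [q = 0]. *)
Definition best_supply i p q : Prop :=
  [/\ 0 <= q, p <= supply_price i q & 0 < q -> supply_price i q <= p].

(** A producer whose marginal cost at [0] is below the clearing price is
    active. *)
Lemma nash_supply_gt0 S i : nash_equilibrium K phat D C S ->
  hderiv (C i) 0 < price S -> 0 < S i (price S).
Proof.
move=> NS cp; have [LS _] := NS; have [pI Dp] := price_clears LS.
have [S0 _ _ _] := LS i.
rewrite lt_neqAle S0// andbT; apply/eqP => q0.
have p0 : 0 < price S by rewrite (le_lt_trans _ cp)// marginal_cost_ge0.
have := @nash_price_le_of_slope S i gamma (price S) NS.
rewrite -q0 !mul0r !add0r mulr_gt0// leNgt cp/= => h.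
suff : false by []; apply: h => // e e0 ep.
rewrite subrr mul0r.
have peI : price S - e \in `[0, phat].
  by move: pI; rewrite !in_itv/= => /andP[? ?]; apply/andP; split; lra.
have pep : price S - e <= price S by rewrite gerBl ltW.
by have /andP[] := rivals_le i LS peI pI pep.
Qed.

(** When all producers are active, the residual demand just below the clearing
    price has slope [residual_slope]. *)
Lemma nash_price_le_supply_price S i : nash_equilibrium K phat D C S ->
  (forall j, 0 < S j (price S)) ->
  price S <= supply_price i (S i (price S)).
Proof.
move=> NS q0; have [LS _] := NS; have [pI Dp] := price_clears LS.
have M0 := residual_slope_gt0; set p := price S in pI Dp q0 *.
have sle j := nash_supply_price_le NS (q0 j).
have x0 j : S j p / K < p.
  apply: lt_le_trans (sle j); rewrite /supply_price -/p.
  have := marginal_cost_ge0 (hC j) (ltW (q0 j)).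
  have : 0 < S j p / M by rewrite divr_gt0.
  by lra.
(* Below a price drop of e0, all the rivals stay on the rising part of their
   ramps. *)
pose e0 := \big[Num.min/p]_(j < n) (S j p / K).
have e00 : 0 < e0.
  rewrite /e0; elim/big_ind : _ => //.
  - by apply: le_lt_trans (x0 i); rewrite divr_ge0 ?ltW.
  - by move=> x y x_0 y_0; rewrite lt_min x_0.
  - by move=> j _; rewrite divr_gt0.
apply: (@nash_price_le_of_slope S i M e0) => //.
  by rewrite -ltr_pdivrMl// mulrC.
move=> e e_gt0 ee0; rewrite -sumrB [M]/residual_slope addrAC subrr add0r.
rewrite -mulrA mulrCA -(sum_rivals_const i); apply: ler_sum => j _.
have ej : e <= S j p / K.
  by rewrite (le_trans (ltW ee0))// /e0 bigmin_le_cond.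
have peI : p - e \in `[0, p].
  by rewrite in_itv/=; have xj := x0 j; apply/andP; split; lra.
rewrite [S j (p - e)](nash_ramp j NS peI) /ramp -/p.
rewrite max_l; last by lra.
have -> : K * (p - e - (p - S j p / K)) = S j p - K * e.
  by field; exact: lt0r_neq0.
by lra.
Qed.

Lemma nash_best_supply S : (forall i j, hderiv (C i) 0 = hderiv (C j) 0) ->
  nash_equilibrium K phat D C S ->
  forall i, best_supply i (price S) (S i (price S)).
Proof.
move=> hom NS i; have [LS _] := NS; have [pI Dp] := price_clears LS.
have M0 := residual_slope_gt0.
have S0 j : 0 <= S j (price S) by have [S0 _ _ _] := LS j; exact: S0.
split=> //; last exact: nash_supply_price_le.
have [pc|cp] := leP (price S) (hderiv (C i) 0).
  apply: (le_trans pc).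
  apply: (le_trans (marginal_cost_le (hC i) (lexx 0) (S0 i))).
  by rewrite lerDr addr_ge0// divr_ge0// ltW.
apply: nash_price_le_supply_price => // j.
by apply: nash_supply_gt0; rewrite ?(hom j i).
Qed.

(** * Solving the first-order conditions *)

Lemma supply_price_increasing i q q' : 0 <= q -> q <= q' ->
  (q' - q) / K <= supply_price i q' - supply_price i q.
Proof.
move=> q0 qq'; rewrite /supply_price.
have := marginal_cost_le (hC i) q0 qq'.
have : 0 <= (q' - q) / M.
  by rewrite divr_ge0 ?subr_ge0// ltW// residual_slope_gt0.
rewrite !mulrBl; lra.
Qed.

Lemma best_supply_Lip i p p' q q' : best_supply i p q -> best_supply i p' q' ->
  p <= p' -> q <= q' <= q + K * (p' - p).
Proof.
move=> [q0 pq qp] [q'0 pq' qp'] pp'; apply/andP; split.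
  rewrite leNgt; apply/negP => lt_q.
  have := @supply_price_increasing i q' q q'0 (ltW lt_q).
  have := qp (le_lt_trans q'0 lt_q).
  have : 0 < (q - q') / K by rewrite divr_gt0// subr_gt0.
  lra.
rewrite -lerBlDl; have [q'q|lt_q] := leP q' q.
  by rewrite (@le_trans _ _ 0) ?subr_le0// mulr_ge0 ?subr_ge0// ltW.
have := @supply_price_increasing i q q' q0 (ltW lt_q).
have := qp' (le_lt_trans q0 lt_q).
rewrite [K * _]mulrC -ler_pdivrMr//; lra.
Qed.

Lemma best_supply_unique i p q q' :
  best_supply i p q -> best_supply i p q' -> q = q'.
Proof.
move=> b b'; have /andP[h _] := best_supply_Lip b b' (lexx p).
by have /andP[h' _] := best_supply_Lip b' b (lexx p); apply/le_anti/andP.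
Qed.

Lemma best_supply_exists i p : 0 <= p -> exists q, best_supply i p q.
Proof.
move=> p0; have M0 := residual_slope_gt0.
have [pc|cp] := leP p (supply_price i 0).
  by exists 0; split => //; rewrite ltxx.
have Kp0 : 0 <= K * p by rewrite mulr_ge0 ?(ltW K0).
have cs : {within `[0, K * p], continuous (supply_price i)}.
  apply/subspace_continuousP => x /=; rewrite in_itv/= => /andP[x0 _].
  apply: cvgD; first apply: cvgD.
  - by apply: cvgMr_tmp; exact: cvg_within.
  - by apply: cvgMr_tmp; exact: cvg_within.
  apply/cvgrPdist_lt => e e0.
  have [_ [_ dC' _] _ _] := hC i.
  have [r r0 rP] := hderivable_continuous dC' x0 e0.
  rewrite near_withinE; exists r => // y /= xyr.
  rewrite in_itv/= => /andP[y0 _].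
  by rewrite distrC rP// distrC.
have [|q qI gq] := IVT Kp0 cs (v := p).
  rewrite ge_min le_max ltW//=; apply/orP; right.
  rewrite /supply_price [K * p / K]mulrAC divff ?lt0r_neq0// mul1r.
  have := marginal_cost_ge0 (hC i) Kp0.
  have : 0 <= K * p / M by rewrite divr_ge0// ltW.
  lra.
move: qI; rewrite in_itv/= => /andP[q0 _].
by exists q; split; rewrite ?gq.
Qed.

(** The quantity satisfying the first-order conditions at price [p >= 0]; it
    exists and is unique there, so the default value of [xget] plays no role. *)
Definition supply i p : R := xget 0 [set q | best_supply i p q].

Lemma supplyP i p : 0 <= p -> best_supply i p (supply i p).
Proof. by move=> p0; apply: xgetPex; exact: best_supply_exists. Qed.

Lemma supplyE i p q : best_supply i p q -> q = supply i p.
Proof.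
by move=> b; apply: (best_supply_unique b); apply: (xgetI _ b).
Qed.

Lemma supply_Lip i : Lip K phat (supply i).
Proof.
split.
- by move=> p; rewrite in_itv/= => /andP[p0 _]; have [] := supplyP i p0.
- apply/esym/supplyE; split => //; last by rewrite ltxx.
  by rewrite /supply_price !mul0r !add0r marginal_cost_ge0.
- move=> a b; rewrite !in_itv/= => /andP[a0 _] /andP[b0 _] ab.
  by have /andP[] := best_supply_Lip (supplyP i a0) (supplyP i b0) ab.
- move=> [a b] [/=]; rewrite !in_itv/= => /andP[a0 _] /andP[b0 _].
  wlog ab : a b a0 b0 / a <= b.
    move=> wl; have [|/ltW] := leP a b; first exact: wl.
    by rewrite distrC [X in _ * X]distrC; exact: wl.
  have /andP[h1 h2] := best_supply_Lip (supplyP i a0) (supplyP i b0) ab.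
  by rewrite distrC [X in _ * X]distrC !ger0_norm ?subr_ge0// lerBlDl.
Qed.

(** The price at which the market clears against the quantities [supply]. *)
Definition equilibrium_price : R := price supply.

(** The threshold of the ramp of slope [K] that sells [supply i] at the
    equilibrium price. *)
Definition entry_price i : R :=
  equilibrium_price - supply i equilibrium_price / K.

(** All equilibria share the same clearing price and quantities. *)
Lemma nash_price S : (forall i j, hderiv (C i) 0 = hderiv (C j) 0) ->
  nash_equilibrium K phat D C S ->
  price S = equilibrium_price /\
  forall i, S i equilibrium_price = supply i equilibrium_price.
Proof.
move=> hom NS; have [LS _] := NS; have [pI Dp] := price_clears LS.
have Sp i : S i (price S) = supply i (price S).
  exact/supplyE/nash_best_supply.
have E : price S = equilibrium_price.
  apply/esym/price_eq; first exact: supply_Lip.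
  by split => //; rewrite Dp; apply: eq_bigr.
by split=> // i; rewrite -E.
Qed.

Lemma equilibrium_price_clears : clears phat D supply equilibrium_price.
Proof. exact/price_clears/supply_Lip. Qed.

Lemma equilibrium_price_ge0 : 0 <= equilibrium_price.
Proof.
by have [+ _] := equilibrium_price_clears; rewrite in_itv/= => /andP[]. Qed.

Lemma entry_price_itv i : entry_price i \in `[0, equilibrium_price].
Proof.
have [pI _] := equilibrium_price_clears.
have [q0 _ _] := supplyP i equilibrium_price_ge0.
rewrite in_itv/= /entry_price gerBl divr_ge0 ?(ltW K0)// andbT.
by rewrite subr_ge0 ler_pdivrMr// mulrC (Lip_le (supply_Lip i)).
Qed.

Lemma ramp_entry_price i :
  ramp K (entry_price i) equilibrium_price = supply i equilibrium_price.
Proof.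
have [q0 _ _] := supplyP i equilibrium_price_ge0.
rewrite /ramp subKr max_l ?divr_ge0 ?(ltW K0)//.
by rewrite mulrC divfK ?lt0r_neq0.
Qed.

(** With homogeneous marginal costs at 0, one inactive producer means that
    nobody sells. *)
Lemma equilibrium_price_of_inactive i :
  (forall i j, hderiv (C i) 0 = hderiv (C j) 0) ->
  supply i equilibrium_price = 0 -> equilibrium_price = phat.
Proof.
move=> hom qi0; have [pI Dp] := equilibrium_price_clears.
have M0 := residual_slope_gt0; have p0 := equilibrium_price_ge0.
have [_ pc _] := supplyP i p0.
rewrite qi0 /supply_price !mul0r !add0r in pc.
have q0 j : supply j equilibrium_price = 0.
  have [qj0 _ qjp] := supplyP j p0.
  apply/eqP; rewrite eq_le qj0 andbT leNgt; apply/negP => qj.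
  have := qjp qj; rewrite /supply_price.
  have := marginal_cost_le (hC j) (lexx 0) qj0; rewrite (hom j i).
  have : 0 < supply j equilibrium_price / K by rewrite divr_gt0.
  have : 0 < supply j equilibrium_price / M by rewrite divr_gt0.
  lra.
move: Dp; rewrite big1 // /affine_demand => /eqP.
by rewrite mulf_eq0 gt_eqF//= subr_eq0 => /eqP.
Qed.

(** * Existence of an equilibrium *)

(** The first-order conditions are sufficient: along a line of slope
    [residual_slope] through [(p, q)], the payoff is concave in the quantity,
    and a point below that line earns less than the point of the line with the
    same quantity. *)
Lemma payoff_best_supply i p q p' q' : best_supply i p q -> 0 <= q' ->
  q' <= q - M * (p' - p) -> payoff i p' q' <= payoff i p q.
Proof.
move=> [q0 pq qp] q'0 q'M; have M0 := residual_slope_gt0.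
have subg := cost_subgradient (hC i) q0 q'0.
have kkt : (q' - q) * (p - supply_price i q) <= 0.
  move: q0; rewrite le_eqVlt => /predU1P[q0|/qp gp].
    by rewrite -q0 subr0 mulr_ge0_le0// subr_le0 q0.
  by rewrite (_ : p - _ = 0) ?mulr0//; lra.
have h1 : p' * q' <= (p - (q' - q) / M) * q'.
  rewrite ler_wpM2r// -(ler_pM2l M0) mulrBr [M * (_ / _)]mulrC.
  rewrite divfK ?lt0r_neq0//.
  lra.
have h2 : 0 <= (q' - q) ^+ 2 / M by rewrite divr_ge0 ?sqr_ge0// ltW.
have h3 : 0 <= (q' - q) ^+ 2 / (2 * K).
  by rewrite divr_ge0 ?sqr_ge0// mulr_ge0// ltW.
have E : (p - (q' - q) / M) * q' - q' ^+ 2 / (2 * K) -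
    (C i q + hderiv (C i) q * (q' - q)) = payoff i p q +
    (q' - q) * (p - supply_price i q) - (q' - q) ^+ 2 / M
    - (q' - q) ^+ 2 / (2 * K).
  by rewrite /payoff /supply_price; field; rewrite !lt0r_neq0.
rewrite {1}/payoff; lra.
Qed.

(** Rivals playing ramps whose thresholds do not exceed the equilibrium price
    supply at least their linear extrapolation at any other price, which bounds
    the residual demand by a line of slope [residual_slope]. *)
Lemma ramp_nash : nash_equilibrium K phat D C (fun i => ramp K (entry_price i)).
Proof.
set S := fun i => _; have [pI Dp] := equilibrium_price_clears.
set p := equilibrium_price in pI Dp.
have ent i : 0 <= entry_price i <= p.
  by have := entry_price_itv i; rewrite in_itv.
have LS i : Lip K phat (S i) by apply: ramp_Lip => //; case/andP: (ent i).
have Sp i : S i p = supply i p := ramp_entry_price i.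
have pE : price S = p.
  by apply: price_eq => //; split => //; rewrite Dp; apply: eq_bigr.
split=> // i F LF; have LD := deviate_Lip i LS LF.
have /andP[e0 ep] := ent i.
rewrite (utility_ramp LS e0) ?pE//.
apply: le_trans (utility_le_payoff i LD).1 _.
have [p'I] := price_clears LD; set p' := price _ in p'I *.
rewrite sum_deviate deviate_same => Dp'.
rewrite Sp; apply: payoff_best_supply.
  exact: supplyP equilibrium_price_ge0.
  by have [F0 _ _ _] := LF; exact: F0.
rewrite (sum_rivals _ i) in Dp.
have : rivals supply i p + K * n.-1%:R * (p' - p) <= rivals S i p'.
  rewrite -mulrA mulrCA -(sum_rivals_const i) -big_split.
  apply: ler_sum => j _ /=.
  rewrite -Sp /S /ramp max_l ?subr_ge0; last by case/andP: (ent j).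
  by rewrite -mulrDr ler_pM2l// le_max; apply/orP; left; lra.
move: Dp Dp'; rewrite /affine_demand /residual_slope mulrDl; lra.
Qed.

End Game.

Theorem corollary2 (R : realType) (n : nat) (C : 'I_n -> R -> R)
    (gamma phat : R)
    (n_gt0 : (0 < n)%N)
    (hC : forall i, cost_function (C i))
    (gamma_gt0 : 0 < gamma) (phat_gt0 : 0 < phat)
    (hom : forall i j, hderiv (C i) 0 = hderiv (C j) 0) :
  forall K : R, 0 < K ->
  exists! x : 'I_n -> R,
    (forall i, x i \in `[0, phat]) /\
    (forall S : 'I_n -> R -> R,
       nash_equilibrium K phat (affine_demand gamma phat) C S ->
       forall (i : 'I_n) (p : R),
         p \in `[0, clearing_price phat (affine_demand gamma phat) S] ->
         S i p = K * Num.max (p - x i) 0).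
Proof.
move=> K K_gt0.
pose xs := entry_price K gamma phat C.
pose ps := equilibrium_price K gamma phat C.
have [psI Dps] := equilibrium_price_clears K_gt0 gamma_gt0 phat_gt0 hC.
rewrite -/ps in psI Dps.
have xsI i : xs i \in `[0, ps] by exact: entry_price_itv.
exists xs; split.
  split=> [i|S NS i p].
    move: (xsI i) psI; rewrite !in_itv/= => /andP[-> h] /andP[_].
    exact: le_trans.
  have [pE Sp] := nash_price K_gt0 gamma_gt0 phat_gt0 hC hom NS.
  by move=> pI; rewrite (nash_ramp K_gt0 gamma_gt0 phat_gt0 i NS pI) pE Sp.
move=> x' [x'I x'P]; apply/funext => i.
have NS := ramp_nash K_gt0 gamma_gt0 phat_gt0 hC.
have [pE Sp] := nash_price K_gt0 gamma_gt0 phat_gt0 hC hom NS.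
have psI' : ps \in `[0, clearing_price phat (affine_demand gamma phat)
    (fun i => ramp K (xs i))].
  by rewrite pE; move: psI; rewrite !in_itv/= lexx andbT => /andP[].
have := x'P _ NS i ps psI'.
rewrite Sp -/ps => qE; rewrite /xs /entry_price -/ps.
(* If i sells nothing, then ps = phat, so that x' i >= ps leaves one value. *)
have [x'p|px'] := ltP (x' i) ps.
  rewrite qE max_l ?subr_ge0 1?ltW// mulrAC divff ?lt0r_neq0// mul1r.
  by rewrite subKr.
rewrite max_r ?subr_le0// mulr0 in qE.
have psE := equilibrium_price_of_inactive K_gt0 gamma_gt0 phat_gt0 hC hom qE.
rewrite qE mul0r subr0; apply/le_anti; rewrite px'/= /ps psE.
by have := x'I i; rewrite in_itv => /andP[].
Qed.
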